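(* The generators $d_i$, $u_i$, $t_i$ together with the relations listed below constitute a presentation of the category $\mathbf{Fin}^{op}$. That is: let $\mathcal{C}$ be the quotient of the free category with objects $[n]$ ($n\ge 0$) and generating arrows $d_i:[n]\to[n-1]$ ($n\ge1$, $0\le i\le n$), $u_i:[n]\to[n+1]$ ($n\ge 0$, $1\le i\le n+1$), $t_i:[n]\to[n]$ ($n\ge1$, $0\le i\le n-1$) by the relations below (imposed for all objects and all indices for which the expressions are defined); then the functor $\mathcal{C}\to\mathbf{Fin}^{op}$ that is the identity on objects and sends each generator to the function of the same name is well defined and is an isomorphism of categories. Here $z_j$ abbreviates the word $t_{j-1}\cdots t_1t_0$ (and $z_0=\mathrm{id}$). The relations are: $$d_id_j=\begin{cases} d_{j-1}d_i & i<j\\ d_jd_{i+1} & i\ge j\end{cases}$$ $$d_iu_j=\begin{cases} z_{j-1} & i=0\\ u_{j-1}d_i & 0\ne i<j\\ \mathrm{id} & i=j\\ u_jd_{i-1} & i>j\end{cases}\qquad u_id_j=\begin{cases} d_{j+1}u_i & i\le j\\ d_ju_{i+1} & i\ge j\ne 0\\ d_1u_{i+1}t_0 & j=0\end{cases}$$ $$u_iu_j=\begin{cases} u_{j+1}u_i & i\le j\\ u_ju_{i-1} & i>j\end{cases}\qquad t_it_j=\begin{cases}\mathrm{id} & i=j\\ t_jt_i & |i-j|\ge2\\ (t_jt_i)^2 & |i-j|=1\end{cases}$$ $$d_it_j=\begin{cases} t_{j-1}d_i & i<j\\ d_{i+1} & i=j\\ d_{i-1} & i=j+1\\ t_jd_i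 & i\ge j+2\end{cases}\qquad t_id_j=\begin{cases} d_jt_i & i\le j-2\\ d_jt_{i+1}t_it_{i+1} & i=j-1\\ d_jt_{i+1} & i\ge j\end{cases}$$ $$t_iu_j=\begin{cases} u_jt_i & 0\ne i\le j-2\\ u_{j-1} & 0\ne i=j-1\\ u_{j+1} & i=j\\ u_jt_{i-1} & i>j\end{cases}\qquad u_it_j=\begin{cases} t_{j+1}u_i & i\le j\\ t_jt_{j+1}u_{i-1} & i=j+1\text{ and }j\ne0\\ t_ju_i & i\ge j+2\text{ and }j\neq 0\end{cases}$$ $$t_0u_1=u_1,\qquad t_0u_it_0u_j=\begin{cases} u_{j+1}t_0u_it_0 & 2\le i\le j\\ u_jt_0u_{i-1}t_0 & 2\le j<i.\end{cases}$$
   Context: For $n\ge0$, $[n]=\{0,1,\dots,n\}$. $\mathbf{Fin}$ is the category with objects $[n]$ ($n\ge 0$) and with morphisms all functions $[n]\to[m]$. Products are written in $\mathbf{Fin}^{op}$: the product $xy$ in $\mathbf{Fin}^{op}$ is the function ''first $x$, then $y$''. The generators correspond to the following functions (superscripts indicating dimension are suppressed): - $d_i=d_i^{(n)}:[n-1]\to[n]$ ($n\ge1$, $0\le i\le n$): $k\mapsto k$ for $k<i$ and $k\mapsto k+1$ for $k\ge i$ (the monotonic injection missing $i$). - $u_i=u_i^{(n)}:[n+1]\to[n]$ ($n\ge0$, $1\le i\le n+1$): $0\mapsto0$, $i\mapsto 0$, $k\mapsto k$ for $1\le k\le i-1$, $k\mapsto k-1$ for $k>i$. There is no $u_0$. -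 $t_i=t_i^{(n)}:[n]\to[n]$ ($n\ge1$, $0\le i\le n-1$): the transposition exchanging $i$ and $i+1$. As morphisms of $\mathbf{Fin}^{op}$ these have source and target interchanged. *)

(* Defs.v *)
From mathcomp Require Import all_boot.
From mathcomp Require Import generic_quotient boolp.

Set Implicit Arguments.
Unset Strict Implicit.
Unset Printing Implicit Defensive.

Local Open Scope quotient_scope.

(** * Categories, functors, isomorphisms of categories *)

(* Homs are compared by Leibniz equality.  Composition is written in the usual
   order: [g \oc f] is "g after f". *)
Record category := Category {
  ob :> Type;
  hom : ob -> ob -> Type;
  idc : forall x, hom x x;
  compc : forall x y z, hom y z -> hom x y -> hom x z;
  compc1 : forall x y (f : hom x y), compc f (idc x) = f;
  comp1c : forall x y (f : hom x y), compc (idc y) f = f;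
  compcA : forall x y z t (h : hom z t) (g : hom y z) (f : hom x y),
    compc h (compc g f) = compc (compc h g) f }.

Arguments hom {C} x y : rename.
Arguments idc {C} x : rename.
Arguments compc {C x y z} g f : rename.

Notation "g \oc f" := (compc g f) (at level 40, left associativity).

Record functor (A B : category) := Functor {
  fob :> A -> B;
  fhom : forall x y : A, hom x y -> hom (fob x) (fob y);
  fhom1 : forall x : A, fhom (idc x) = idc (fob x);
  fhomM : forall (x y z : A) (g : hom y z) (f : hom x y),
    fhom (g \oc f) = fhom g \oc fhom f }.

Arguments fhom {A B} F {x y} f : rename.

Definition id_functor (A : category) : functor A A :=
  @Functor A A id (fun x y f => f) (fun _ => erefl) (fun _ _ _ _ _ => erefl).

Section CompFunctor.
Variables (A B C : category) (G : functor B C) (F : functor A B).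

Let ghom x y (f : hom x y) := fhom G (fhom F f).

Lemma comp_functor1 x : ghom (idc x) = idc (G (F x)).
Proof. by rewrite /ghom !fhom1. Qed.

Lemma comp_functorM x y z (g : hom y z) (f : hom x y) :
  ghom (g \oc f) = ghom g \oc ghom f.
Proof. by rewrite /ghom !fhomM. Qed.

Definition comp_functor : functor A C :=
  @Functor A C (fun x => G (F x)) ghom comp_functor1 comp_functorM.
End CompFunctor.

Definition is_isomorphism (A B : category) (F : functor A B) : Prop :=
  exists G : functor B A,
    comp_functor G F = id_functor A /\ comp_functor F G = id_functor B.

Definition opposite (C : category) : category :=
  @Category C (fun x y => @hom C y x) (fun x => idc x)
    (fun x y z g f => f \oc g)
    (fun x y f => comp1c f) (fun x y f => compc1 f)
    (fun x y z t h g f => esym (compcA f g h)).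

(** * Free category on a quiver *)

Section Free.
Variables (V : Type) (E : V -> V -> Type).

(* [Cons a p] is the word [a p]: its head letter is the arrow followed last,
   in accordance with the order of composition. *)
Inductive quiver_path : V -> V -> Type :=
| Nil x : quiver_path x x
| Cons x y z of E y z & quiver_path x y : quiver_path x z.

Fixpoint pcat y z (q : quiver_path y z) :
    forall x, quiver_path x y -> quiver_path x z :=
  match q in quiver_path y z
    return forall x, quiver_path x y -> quiver_path x z with
  | Nil _ => fun _ p => p
  | Cons _ _ _ a q' => fun _ p => Cons a (pcat q' p)
  end.

Lemma pcat1 x y (p : quiver_path x y) : pcat p (Nil x) = p.
Proof. by elim: p => //= {}x {}y z a p ->. Qed.

Lemma pcatA x y z t
    (r : quiver_path z t) (q : quiver_path y z) (p : quiver_path x y) :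
  pcat r (pcat q p) = pcat (pcat r q) p.
Proof. by elim: r q => //= z1 z2 z3 a r IH q; rewrite IH. Qed.

Definition free_category : category :=
  @Category V quiver_path Nil (fun _ _ _ q p => pcat q p)
    pcat1 (fun _ _ _ => erefl) pcatA.

Section FreeLift.
Variables (B : category) (o : V -> B)
  (e : forall x y, E x y -> hom (o x) (o y)).

Fixpoint eval x y (p : quiver_path x y) : hom (o x) (o y) :=
  match p in quiver_path x y return hom (o x) (o y) with
  | Nil x => idc (o x)
  | Cons _ _ _ a p' => e a \oc eval p'
  end.

Lemma evalM x y z (q : quiver_path y z) (p : quiver_path x y) :
  eval (pcat q p) = eval q \oc eval p.
Proof.
by elim: q p => [y' p|x' y' z' a q IH p] /=; rewrite ?comp1c // IH compcA.
Qed.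

Definition free_lift : functor free_category B :=
  @Functor free_category B o eval (fun _ => erefl) evalM.
End FreeLift.
End Free.

Arguments Nil {V E} x.
Arguments Cons {V E x y z} a p.

(** * Quotient of a category by relations between parallel arrows *)

Section Quotient.
Variables (C : category) (R : forall x y : C, hom x y -> hom x y -> Prop).

(* the congruence generated by [R] *)
Inductive cong : forall x y : C, hom x y -> hom x y -> Prop :=
| cong_rel x y (f g : hom x y) of R f g : cong f g
| cong_refl x y (f : hom x y) : cong f f
| cong_sym x y (f g : hom x y) of cong f g : cong g f
| cong_trans x y (f g h : hom x y) of cong f g & cong g h : cong f h
| cong_comp x y z (g g' : hom y z) (f f' : hom x y) of
    cong g g' & cong f f' : cong (g \oc f) (g' \oc f').

Section Hom.
Variables x y : C.

Definition congb (f g : {classic @hom C x y}) : bool := `[< cong f g >].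

Lemma congb_refl : reflexive congb.
Proof. by move=> f; apply/asboolP/cong_refl. Qed.

Lemma congb_sym : symmetric congb.
Proof. by move=> f g; apply/asboolP/asboolP; apply: cong_sym. Qed.

Lemma congb_trans : transitive congb.
Proof.
by move=> g f h /asboolP fg /asboolP gh; apply/asboolP/(cong_trans fg gh).
Qed.

Canonical congb_equiv := EquivRel congb congb_refl congb_sym congb_trans.

Definition qhom := {eq_quot congb}.

Definition qclass (f : hom x y) : qhom := \pi_qhom (f : {classic hom x y}).

Definition qrepr (a : qhom) : hom x y := repr a.

Lemma qreprK a : qclass (qrepr a) = a.
Proof. exact: reprK. Qed.

Lemma qclassP (f g : hom x y) : qclass f = qclass g <-> cong f g.
Proof.
split; first by move=> /eqmodP/asboolP.
by move=> fg; apply/eqmodP/asboolP.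
Qed.

Lemma qrepr_cong (f : hom x y) : cong (qrepr (qclass f)) f.
Proof. by apply/qclassP; rewrite qreprK. Qed.
End Hom.

Definition qcomp x y z (b : qhom y z) (a : qhom x y) : qhom x z :=
  qclass (qrepr b \oc qrepr a).

Lemma qcompE x y z (g : hom y z) (f : hom x y) :
  qcomp (qclass g) (qclass f) = qclass (g \oc f).
Proof. by apply/qclassP/cong_comp; apply: qrepr_cong. Qed.

Lemma qcomp1 x y (a : qhom x y) : qcomp a (qclass (idc x)) = a.
Proof. by rewrite -[a]qreprK qcompE compc1. Qed.

Lemma comp1q x y (a : qhom x y) : qcomp (qclass (idc y)) a = a.
Proof. by rewrite -[a]qreprK qcompE comp1c. Qed.

Lemma qcompA x y z t (c : qhom z t) (b : qhom y z) (a : qhom x y) :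
  qcomp c (qcomp b a) = qcomp (qcomp c b) a.
Proof. by rewrite -[a]qreprK -[b]qreprK -[c]qreprK !qcompE compcA. Qed.

Definition quotient_category : category :=
  @Category C qhom (fun x => qclass (idc x)) qcomp qcomp1 comp1q qcompA.

Definition respects (B : category) (F : functor C B) : Prop :=
  forall (x y : C) (f g : hom x y), R f g -> fhom F f = fhom F g.

Section QuotientLift.
Variables (B : category) (F : functor C B) (FR : respects F).

Lemma respects_cong x y (f g : hom x y) : cong f g -> fhom F f = fhom F g.
Proof.
elim=> {x y f g} [x y f g /FR|||x y f g h _ -> _|x y z g g' f f' _ Eg _ Ef] //.
by rewrite !fhomM Eg Ef.
Qed.

Let qlift (x y : quotient_category) (a : hom x y) : hom (F x) (F y) :=
  fhom F (qrepr a).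

Lemma qliftE x y (f : @hom C x y) : qlift (qclass f) = fhom F f.
Proof. exact/respects_cong/qrepr_cong. Qed.

Lemma qlift1 x : qlift (idc x) = idc (F x).
Proof. by rewrite qliftE fhom1. Qed.

Lemma qliftM x y z (b : hom y z) (a : hom x y) :
  qlift (b \oc a) = qlift b \oc qlift a.
Proof. by rewrite qliftE fhomM. Qed.

Definition quotient_lift : functor quotient_category B :=
  @Functor quotient_category B F qlift qlift1 qliftM.

Lemma quotient_liftE x y (f : @hom C x y) :
  fhom quotient_lift (qclass f : @hom quotient_category x y) = fhom F f.
Proof. exact: qliftE. Qed.
End QuotientLift.
End Quotient.

(** * The category Fin *)

(* The object [n] : nat stands for [[n] = {0, ..., n}], that is ['I_n.+1]. *)
Definition Fin : category :=
  @Category nat (fun n m => 'I_n.+1 -> 'I_m.+1) (fun _ => id)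
    (fun _ _ _ g f => g \o f)
    (fun _ _ _ => erefl) (fun _ _ _ => erefl) (fun _ _ _ _ _ _ _ => erefl).

(** * Generators *)

Inductive letter := d_ of nat | u_ of nat | t_ of nat.

(* [arrow a n m]: the letter [a], taken in the appropriate dimension, is a
   generating arrow [[n] -> [m]], in the direction of the opposite of Fin. *)
Definition arrow (a : letter) (n m : nat) : bool :=
  match a with
  | d_ i => (n == m.+1) && (i <= n)
  | u_ i => (m == n.+1) && (1 <= i <= n.+1)
  | t_ i => (m == n) && (i < n)
  end.

Definition generator (n m : nat) : Type := {a : letter | arrow a n m}.

Definition letter_fun (a : letter) (k : nat) : nat :=
  match a with
  | d_ i => if k < i then k else k.+1
  | u_ i => if k < i then k else if k == i then 0 else k.-1
  | t_ i => if k == i then i.+1 else if k == i.+1 then i else k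
  end.

Lemma letter_fun_bound a n m k :
  arrow a n m -> k < m.+1 -> letter_fun a k < n.+1.
Proof.
case: a => i /= /andP[/eqP->].
- by move=> _ km; case: ifP => // _; apply: ltnW.
- case/andP=> i0 ile km; case: ifP => [ki|_]; first exact: leq_trans ki ile.
  by case: ifP => // _; case: k km.
- by move=> lin km; do 2![case: ifP => // _]; apply: ltnW.
Qed.

(* A generating arrow [[n] -> [m]] denotes a function [[m] -> [n]]. *)
Definition generator_fun n m (a : generator n m) : 'I_m.+1 -> 'I_n.+1 :=
  fun k => Ordinal (letter_fun_bound (svalP a) (ltn_ord k)).

Definition free_gen : category := free_category generator.

Definition interp : functor free_gen (opposite Fin) :=
  @free_lift nat generator (opposite Fin) id generator_fun.

(** * Relations *)

(* the word t_(j-1) ... t_1 t_0 *)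
Definition z_ (j : nat) : seq letter := [seq t_ k | k <- rev (iota 0 j)].

(* The relations are listed on words with dimensions erased; [relation] below
   imposes each of them wherever both of its sides are well-typed parallel
   paths.  Index bounds such as i >= 1 for u_i come from this typing.
   Differences are written so as to avoid truncated subtraction: i.+2 <= j for
   i <= j - 2, and i.+1 = j for i = j - 1. *)
Inductive word_rel : seq letter -> seq letter -> Prop :=
| rel_dd_lt i j of i < j :
    word_rel [:: d_ i; d_ j] [:: d_ j.-1; d_ i]
| rel_dd_ge i j of i >= j :
    word_rel [:: d_ i; d_ j] [:: d_ j; d_ i.+1]
| rel_du_0 j :
    word_rel [:: d_ 0; u_ j] (z_ j.-1)
| rel_du_lt i j of i != 0 & i < j :
    word_rel [:: d_ i; u_ j] [:: u_ j.-1; d_ i]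
| rel_du_eq j :
    word_rel [:: d_ j; u_ j] [::]
| rel_du_gt i j of i > j :
    word_rel [:: d_ i; u_ j] [:: u_ j; d_ i.-1]
| rel_ud_le i j of i <= j :
    word_rel [:: u_ i; d_ j] [:: d_ j.+1; u_ i]
| rel_ud_ge i j of i >= j & j != 0 :
    word_rel [:: u_ i; d_ j] [:: d_ j; u_ i.+1]
| rel_ud_0 i :
    word_rel [:: u_ i; d_ 0] [:: d_ 1; u_ i.+1; t_ 0]
| rel_uu_le i j of i <= j :
    word_rel [:: u_ i; u_ j] [:: u_ j.+1; u_ i]
| rel_uu_gt i j of i > j :
    word_rel [:: u_ i; u_ j] [:: u_ j; u_ i.-1]
| rel_tt_eq i :
    word_rel [:: t_ i; t_ i] [::]
| rel_tt_far i j of (i.+2 <= j) || (j.+2 <= i) :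
    word_rel [:: t_ i; t_ j] [:: t_ j; t_ i]
| rel_tt_near i j of (i.+1 == j) || (j.+1 == i) :
    word_rel [:: t_ i; t_ j] [:: t_ j; t_ i; t_ j; t_ i]
| rel_dt_lt i j of i < j :
    word_rel [:: d_ i; t_ j] [:: t_ j.-1; d_ i]
| rel_dt_eq j :
    word_rel [:: d_ j; t_ j] [:: d_ j.+1]
| rel_dt_succ j :
    word_rel [:: d_ j.+1; t_ j] [:: d_ j]
| rel_dt_ge i j of i >= j.+2 :
    word_rel [:: d_ i; t_ j] [:: t_ j; d_ i]
| rel_td_le i j of i.+2 <= j :
    word_rel [:: t_ i; d_ j] [:: d_ j; t_ i]
| rel_td_pred i j of i.+1 = j :
    word_rel [:: t_ i; d_ j] [:: d_ j; t_ i.+1; t_ i; t_ i.+1]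
| rel_td_ge i j of i >= j :
    word_rel [:: t_ i; d_ j] [:: d_ j; t_ i.+1]
| rel_tu_le i j of i != 0 & i.+2 <= j :
    word_rel [:: t_ i; u_ j] [:: u_ j; t_ i]
| rel_tu_pred i j of i != 0 & i.+1 = j :
    word_rel [:: t_ i; u_ j] [:: u_ j.-1]
| rel_tu_eq j :
    word_rel [:: t_ j; u_ j] [:: u_ j.+1]
| rel_tu_gt i j of i > j :
    word_rel [:: t_ i; u_ j] [:: u_ j; t_ i.-1]
| rel_ut_le i j of i <= j :
    word_rel [:: u_ i; t_ j] [:: t_ j.+1; u_ i]
| rel_ut_succ i j of i = j.+1 & j != 0 :
    word_rel [:: u_ i; t_ j] [:: t_ j; t_ j.+1; u_ i.-1]
| rel_ut_ge i j of i >= j.+2 & j != 0 :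
    word_rel [:: u_ i; t_ j] [:: t_ j; u_ i]
| rel_tu_01 :
    word_rel [:: t_ 0; u_ 1] [:: u_ 1]
| rel_tutu_le i j of 2 <= i <= j :
    word_rel [:: t_ 0; u_ i; t_ 0; u_ j] [:: u_ j.+1; t_ 0; u_ i; t_ 0]
| rel_tutu_gt i j of 2 <= j & j < i :
    word_rel [:: t_ 0; u_ i; t_ 0; u_ j] [:: u_ j; t_ 0; u_ i.-1; t_ 0].

Fixpoint word n m (p : quiver_path generator n m) : seq letter :=
  match p with
  | Nil _ => [::]
  | Cons _ _ _ a p' => sval a :: word p'
  end.

Definition relation (n m : free_gen) (p q : hom n m) : Prop :=
  word_rel (word p) (word q).

Definition presented_category : category := quotient_category relation.

(* Main.v *)
Require Import Defs.
From mathcomp Require Import all_boot.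
From mathcomp Require Import boolp zify.

Set Implicit Arguments.
Unset Strict Implicit.
Unset Printing Implicit Defensive.

(** A word in the generators is read from left to right as a composite of
functions; the relations hold in Fin by inspection, and what has to be shown is
that every function is represented by exactly one word up to the relations.

Let [phi_v : [N+1] -> [N]] be the function that sends [n+1] to [v <= n], fixes
[0, ..., n] and lowers every larger number by one.  It is represented by the
conjugate [fold_word n v] of [u_(n+1)] by adjacent transpositions.  A function
[f : [m] -> [n]] is recovered from its values by first moving its domain above
[n] with [d_0^(n+1)], and then folding its elements one after the other onto
their images:
  [f = d_0^(n+1) phi_(f 0) phi_(f 1) ... phi_(f m)],
which is [normal_form].  So every function is represented by a word.

For uniqueness, let a generator [a] act as a function from [[n]] to [[n']].
Since a letter denotes at each larger dimension the extension of its function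
that carries the additional top elements along, one expects
  [phi_v a = a phi_(a v)]   and   [d_0^(n+1) a = d_0^(n'+1)],
and both follow from the relations ([fold_letter], [top_letter]).  Hence
multiplying a normal form by [a] gives again a normal form, that of the
composite function ([normal_form_letter]).  The normal form of the identity
reduces to the empty word ([normal_form_id]), so every word equals the normal
form of the function that it represents ([word_normal_form]), and two words
with the same function are equal.

Words are handled as lists of letters, with only the dimension at which they
start; the passage from lists to paths ([word_eq_cong]) relies on the fact that
a path is determined by its word and its endpoints ([word_inj]). *)

(** * Words and the functions they represent *)

(** A generator [a] that acts as a function out of [[m]] takes values in
[[target a m]]. *)
Definition target (a : letter) (m : nat) : nat :=
  match a with d_ _ => m.+1 | u_ _ => m.-1 | t_ _ => m end.

Definition valid (a : letter) (m : nat) : bool :=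
  match a with d_ i => i <= m.+1 | u_ i => 0 < i <= m | t_ i => i < m end.

Lemma arrowE a n m : arrow a n m = (n == target a m) && valid a m.
Proof. by case: a => i /=; lia. Qed.

Definition wtarget (m : nat) (w : seq letter) : nat :=
  foldl (fun m a => target a m) m w.

Fixpoint wvalid (m : nat) (w : seq letter) : bool :=
  if w is a :: w' then valid a m && wvalid (target a m) w' else true.

Definition word_fun (w : seq letter) (k : nat) : nat :=
  foldl (fun k a => letter_fun a k) k w.

Lemma wtarget_cat m w1 w2 : wtarget m (w1 ++ w2) = wtarget (wtarget m w1) w2.
Proof. exact: foldl_cat. Qed.

Lemma word_fun_cat w1 w2 k :
  word_fun (w1 ++ w2) k = word_fun w2 (word_fun w1 k).
Proof. exact: foldl_cat. Qed.

Lemma wvalid_cat m w1 w2 :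
  wvalid m (w1 ++ w2) = wvalid m w1 && wvalid (wtarget m w1) w2.
Proof. by elim: w1 m => //= a w IH m; rewrite IH andbA. Qed.

(* Innermost conditions come first, and contradictory branches are pruned at
   once: this keeps the nested cases of long words few. *)
Ltac split_ifs :=
  repeat match goal with
  | |- context [if ?b then _ else _] =>
    lazymatch b with
    | context [if _ then _ else _] => fail
    | _ => let E := fresh "E" in case E: b; try (exfalso; lia)
    end
  end.

Lemma z_cons j : z_ j.+1 = t_ j :: z_ j.
Proof. by rewrite /z_ -addn1 iotaD rev_cat. Qed.

Lemma wtarget_z m j : wtarget m (z_ j) = m.
Proof. by elim: j => // j IH; rewrite z_cons. Qed.

Lemma wvalid_z m j : wvalid m (z_ j) = (j <= m).
Proof. by elim: j => [|j IH]; rewrite ?z_cons //= IH; lia. Qed.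

Lemma word_fun_z j k :
  word_fun (z_ j) k = if k < j then k.+1 else if k == j then 0 else k.
Proof.
elim: j k => [|j IH] k; first by case: k.
by rewrite z_cons /= -/(word_fun _ _) IH; split_ifs; lia.
Qed.

Lemma word_rel_target m l r :
  word_rel l r -> wvalid m l -> wvalid m r -> wtarget m l = wtarget m r.
Proof. by case=> {l r} >; rewrite ?wtarget_z ?wvalid_z /=; lia. Qed.

Lemma word_rel_fun m l r k :
  word_rel l r -> wvalid m l -> wvalid m r -> word_fun l k = word_fun r k.
Proof.
by case=> {l r} >; rewrite ?word_fun_z /= => *; split_ifs; lia.
Qed.

(** * Equality of words modulo the relations *)

(** The congruence on words started at a given dimension.  Validity is required
only where a relation is applied: as both sides of a relation are then valid,
the congruence preserves validity, and derivations can ignore it elsewhere. *)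
Inductive word_eq : nat -> seq letter -> seq letter -> Prop :=
| word_eq_rel m l r of word_rel l r & wvalid m l & wvalid m r : word_eq m l r
| word_eq_refl m w : word_eq m w w
| word_eq_sym m w1 w2 of word_eq m w1 w2 : word_eq m w2 w1
| word_eq_trans m w1 w2 w3 of word_eq m w1 w2 & word_eq m w2 w3 :
    word_eq m w1 w3
| word_eq_cat m w1 w1' w2 w2' of
    word_eq m w1 w1' & word_eq (wtarget m w1) w2 w2' :
    word_eq m (w1 ++ w2) (w1' ++ w2').

Lemma word_eq_catl m w w1 w2 :
  word_eq (wtarget m w) w1 w2 -> word_eq m (w ++ w1) (w ++ w2).
Proof. by apply: word_eq_cat; apply: word_eq_refl. Qed.

Lemma word_eq_catr m w w1 w2 : word_eq m w1 w2 -> word_eq m (w1 ++ w) (w2 ++ w).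
Proof. by move=> h; apply: word_eq_cat => //; apply: word_eq_refl. Qed.

Lemma word_eq_cons m a w1 w2 :
  word_eq (target a m) w1 w2 -> word_eq m (a :: w1) (a :: w2).
Proof. exact: (@word_eq_catl m [:: a]). Qed.

Lemma word_eq_head m l r w w' :
  word_rel l r -> wvalid m l -> wvalid m r ->
  word_eq m (r ++ w) w' -> word_eq m (l ++ w) w'.
Proof. by move=> lr ml mr; apply/word_eq_trans/word_eq_catr/word_eq_rel. Qed.

(** A word moves from right to left through three consecutive factors; it may
change on the way ([B3], [B2], [B1], [B0]), and so may the factors.  This is
how letters pass through the conjugates [t_v w t_v]. *)
Lemma word_eq_slide m A1 A2 A3 A1' A2' A3' B0 B1 B2 B3 :
  word_eq (wtarget (wtarget m A1) A2) (A3 ++ B3) (B2 ++ A3') ->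
  word_eq (wtarget m A1) (A2 ++ B2) (B1 ++ A2') ->
  word_eq m (A1 ++ B1) (B0 ++ A1') ->
  word_eq m (A1 ++ A2 ++ A3 ++ B3) (B0 ++ A1' ++ A2' ++ A3').
Proof.
move=> h3 h2 h1; apply: word_eq_trans (word_eq_catl (word_eq_catl h3)) _.
apply: (@word_eq_trans _ _ (A1 ++ B1 ++ A2' ++ A3')).
  apply: word_eq_catl; rewrite (catA A2) (catA B1).
  exact: word_eq_catr.
by rewrite (catA A1) (catA B0); apply: word_eq_catr.
Qed.

Ltac by_relation r :=
  apply: word_eq_rel; [apply: r|..]; rewrite /=; try lia.

Lemma tt_cancel m j w : j < m -> word_eq m [:: t_ j, t_ j & w] w.
Proof.
move=> jm; apply: (@word_eq_catr m w [:: t_ j; t_ j] [::]).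
by_relation rel_tt_eq.
Qed.

(** The given relation [t_j t_(j+1) = (t_(j+1) t_j)^2], multiplied by [t_j] on
the right. *)
Lemma t_braid m j : j.+1 < m ->
  word_eq m [:: t_ j; t_ j.+1; t_ j] [:: t_ j.+1; t_ j; t_ j.+1].
Proof.
move=> h; apply: (@word_eq_head _ [:: t_ j; t_ j.+1]
  [:: t_ j.+1; t_ j; t_ j.+1; t_ j]).
- by apply: rel_tt_near; lia.
- by rewrite /=; lia.
- by rewrite /=; lia.
do 3![apply: word_eq_cons]; by_relation rel_tt_eq.
Qed.

(** * Folding words *)

(** The word [t_(v-1) ... t_0 u_(n+1) t_0 ... t_(v-1)]. *)
Fixpoint fold_word n v : seq letter :=
  if v is v'.+1 then t_ v' :: fold_word n v' ++ [:: t_ v'] else [:: u_ n.+1].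

Lemma wtarget_fold m n v : wtarget m (fold_word n v) = m.-1.
Proof. by elim: v => //= v IH; rewrite wtarget_cat IH. Qed.

(** The letter [t_j] passes unchanged as it fixes [v]; in the word it meets
only letters [t_i] with [i < j - 1] and the letter [u_(n+1)], [j < n]. *)
Lemma fold_t_gt n N v j : v < j < n -> n <= N ->
  word_eq N.+1 (fold_word n v ++ [:: t_ j]) (t_ j :: fold_word n v).
Proof.
move=> vj nN; elim: v vj => [|v IH] vj /=; first by_relation rel_ut_ge.
rewrite -catA.
apply: (@word_eq_slide N.+1 [:: t_ v] _ [:: t_ v] [:: t_ v] _ [:: t_ v]
  [:: t_ j] [:: t_ j] [:: t_ j] [:: t_ j]); rewrite ?wtarget_fold /=.
- by_relation rel_tt_far.
- by apply: IH; lia.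
- by_relation rel_tt_far.
Qed.

Lemma fold_t n N v j : j < n -> v <= n -> n <= N ->
  word_eq N.+1 (fold_word n v ++ [:: t_ j])
    (t_ j :: fold_word n (letter_fun (t_ j) v)).
Proof.
move=> jn vn nN; elim: v vn => [|v IH] vn.
  case: j jn => [|j] jn; last by apply: fold_t_gt => //; lia.
  by apply: word_eq_sym; apply: tt_cancel; lia.
rewrite /=; case: (ltngtP v j) => [vj|vj|->].
- case: (eqVneq v.+1 j) => [<-|vj'].
  - by apply: word_eq_sym; apply: tt_cancel; lia.
  - by rewrite ifF; [apply: (@fold_t_gt n N v.+1); lia|lia].
- have -> : (v.+1 == j) = false by lia.
  rewrite -catA /=.
  have [Ev|vj'] := eqVneq v j.+1.
    subst v; rewrite ifF; last lia.
    (* The braid relation turns the right end [t_j t_(j+1) t_j] into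
       [t_(j+1) t_j t_(j+1)]; the first of these letters commutes with
       [fold_word n j], and a second braid move on the left end frees [t_j]. *)
    rewrite [fold_word n j.+2]/=.
    rewrite -[fold_word n j.+1]/(t_ j :: fold_word n j ++ [:: t_ j]) /= -!catA.
    rewrite /=.
    apply: (@word_eq_trans _ _ ([:: t_ j.+1; t_ j] ++
        (fold_word n j ++ [:: t_ j.+1]) ++ [:: t_ j; t_ j.+1])).
      rewrite /= -!catA; do 2!apply: word_eq_cons.
      by apply: word_eq_catl; rewrite wtarget_fold /=; apply: t_braid; lia.
    apply: (@word_eq_trans _ _ ([:: t_ j.+1; t_ j] ++
        (t_ j.+1 :: fold_word n j) ++ [:: t_ j; t_ j.+1])).
      by apply: word_eq_catl; apply: word_eq_catr; apply: fold_t_gt => /=; lia.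
    rewrite /=; apply: (@word_eq_catr _ _ [:: t_ j.+1; t_ j; t_ j.+1]
      [:: t_ j; t_ j.+1; t_ j]).
    by apply: word_eq_sym; apply: t_braid; lia.
  move: IH; rewrite /= !ifF; try lia; move=> IH.
  rewrite [fold_word n v.+1]/=.
  apply: (@word_eq_slide N.+1 [:: t_ v] _ [:: t_ v]
    [:: t_ v] (fold_word n v) [:: t_ v]
    [:: t_ j] [:: t_ j] [:: t_ j] [:: t_ j]); rewrite ?wtarget_fold /=.
  - by_relation rel_tt_far.
  - by apply: IH; lia.
  - by_relation rel_tt_far.
- have -> : (j.+1 == j) = false by lia.
  rewrite eqxx /= -catA; apply: word_eq_cons.
  rewrite -[X in word_eq _ _ X]cats0; apply: word_eq_catl.
  by rewrite wtarget_fold; apply: tt_cancel => /=; lia.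
Qed.

Lemma fold_d n N v j : j <= n.+1 -> v <= n -> n <= N ->
  word_eq N.+1 (fold_word n v ++ [:: d_ j])
    (d_ j :: fold_word n.+1 (letter_fun (d_ j) v)).
Proof.
move=> jn vn nN; elim: v vn => [|v IH] vn.
  case: j jn => [|j] jn; last by_relation rel_ud_ge.
  rewrite /=; apply: (@word_eq_trans _ _ [:: d_ 1; u_ n.+2; t_ 0]).
    by_relation rel_ud_0.
  apply: word_eq_sym; apply: (@word_eq_head _ [:: d_ 0; t_ 0]).
  - exact: rel_dt_eq.
  - by rewrite /=; lia.
  - by rewrite /=; lia.
  exact: word_eq_refl.
have {}IH := IH (ltnW vn); move: IH.
rewrite /= -catA /=; case: (ltngtP v.+1 j) => vj.
- move=> IH.
  apply: (@word_eq_slide N.+1 [:: t_ v] _ [:: t_ v]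
    [:: t_ v] (fold_word n.+1 v) [:: t_ v]
    [:: d_ j] [:: d_ j] [:: d_ j] [:: d_ j]); rewrite ?wtarget_fold //=;
    by_relation rel_td_le.
- move=> IH.
  apply: (@word_eq_slide N.+1 [:: t_ v] _ [:: t_ v]
    [:: t_ v.+1] (fold_word n.+1 v.+1) [:: t_ v.+1]
    [:: d_ j] [:: d_ j] [:: d_ j] [:: d_ j]); rewrite ?wtarget_fold //=;
    by_relation rel_td_ge.
move=> IH; subst j; rewrite [fold_word n.+1 v.+2]/= -!catA /=.
(* For [j = v + 1] the letter [d_j] leaves [t_(v+1) t_v t_(v+1)] in place of
   either [t_v]; the inner [t_(v+1)] on the left commutes with
   [fold_word n.+1 v] and cancels the one on the right. *)
apply: (@word_eq_trans _ _ ([:: t_ v] ++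
    (fold_word n v ++ [:: d_ v.+1]) ++ [:: t_ v.+1; t_ v; t_ v.+1])).
  rewrite /= -!catA; apply: word_eq_cons; apply: word_eq_catl.
  rewrite wtarget_fold.
  by_relation rel_td_pred.
apply: (@word_eq_trans _ _ ([:: t_ v; d_ v.+1] ++
    fold_word n.+1 v ++ [:: t_ v.+1; t_ v; t_ v.+1])).
  by apply: word_eq_cons; rewrite -cat_cons; apply: word_eq_catr.
apply: (@word_eq_trans _ _ ([:: d_ v.+1; t_ v.+1; t_ v] ++
    (t_ v.+1 :: fold_word n.+1 v) ++ [:: t_ v.+1; t_ v; t_ v.+1])).
  apply: (@word_eq_catr _ _ [:: t_ v; d_ v.+1]
    [:: d_ v.+1; t_ v.+1; t_ v; t_ v.+1]).
  by_relation rel_td_pred.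
do 3![apply: word_eq_cons].
apply: (@word_eq_trans _ _ ((fold_word n.+1 v ++ [:: t_ v.+1]) ++
    [:: t_ v.+1; t_ v; t_ v.+1])).
  by apply: word_eq_catr; apply: word_eq_sym; apply: fold_t_gt; lia.
rewrite /= -!catA; apply: word_eq_catl; rewrite wtarget_fold.
by apply: tt_cancel => /=; lia.
Qed.

Lemma fold_u n N v j : 0 < j <= n.+1 -> v <= n.+1 -> n < N ->
  word_eq N.+1 (fold_word n.+1 v ++ [:: u_ j])
    (u_ j :: fold_word n (letter_fun (u_ j) v)).
Proof.
move=> jn vn nN; elim: v j jn vn => [|v IH] j jn vn.
  case: j jn => [|j] jn //=; by_relation rel_uu_gt.
have [Ev|v0] := posnP v.
  subst v; case: j jn => [|[|j]] jn //=.
    apply: (@word_eq_trans _ _ ([:: t_ 0; u_ n.+2; u_ 1])).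
      do 2![apply: word_eq_cons]; by_relation rel_tu_01.
    apply: (@word_eq_trans _ _ ([:: t_ 0; u_ 1; u_ n.+1])).
      by apply: word_eq_cons; by_relation rel_uu_gt.
    apply: (@word_eq_catr _ [:: u_ n.+1] [:: t_ 0; u_ 1] [:: u_ 1]).
    by_relation rel_tu_01.
  by_relation rel_tutu_gt.
rewrite [fold_word n.+1 v.+1]/= cat_cons -catA.
have [vj|vj] := boolP ((v.+1 < j) || (j < v)).
  have := IH j jn (ltnW vn); have [{}vj|jv] := orP vj.
    rewrite /= (ltnW vj) vj => {}IH.
    apply: (@word_eq_slide N.+1 [:: t_ v] _ [:: t_ v]
      [:: t_ v] (fold_word n v) [:: t_ v]
      [:: u_ j] [:: u_ j] [:: u_ j] [:: u_ j]); rewrite ?wtarget_fold //=;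
      by_relation rel_tu_le.
  rewrite /= !ifF; try lia; case: v v0 vn jv {vj IH} => // v _ vn jv IH.
  apply: (@word_eq_slide N.+1 [:: t_ v.+1] _ [:: t_ v.+1]
    [:: t_ v] (fold_word n v) [:: t_ v]
    [:: u_ j] [:: u_ j] [:: u_ j] [:: u_ j]); rewrite ?wtarget_fold //=;
    by_relation rel_tu_gt.
(* If [j] is [v + 1] or [v], then [t_v u_j] is [u_v] or [u_(v+1)]: the last
   [t_v] is absorbed, and the index is restored when [u] meets the first
   [t_v].  Hence the induction is on all [j] simultaneously. *)
have [Ej|Ej] : j = v.+1 \/ j = v by lia.
  subst j; rewrite /= ltnn eqxx.
  apply: (@word_eq_trans _ _ ([:: t_ v] ++ fold_word n.+1 v ++ [:: u_ v])).
    apply: word_eq_cons; apply: word_eq_catl; rewrite wtarget_fold.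
    by_relation rel_tu_pred.
  apply: (@word_eq_trans _ _ ([:: t_ v; u_ v] ++ fold_word n 0)).
    apply: word_eq_cons; have := IH v _ _; rewrite /= ltnn eqxx; apply; lia.
  apply: (@word_eq_catr _ _ [:: t_ v; u_ v] [:: u_ v.+1]).
  by_relation rel_tu_eq.
subst j; rewrite /= ltnNge leqnSn /= ifF; last lia.
apply: (@word_eq_trans _ _ ([:: t_ v] ++ fold_word n.+1 v ++ [:: u_ v.+1])).
  apply: word_eq_cons; apply: word_eq_catl; rewrite wtarget_fold.
  by_relation rel_tu_eq.
apply: (@word_eq_trans _ _ ([:: t_ v; u_ v.+1] ++ fold_word n v)).
  apply: word_eq_cons; have := IH v.+1 _ _; rewrite /= ltnS leqnn; apply; lia.
apply: (@word_eq_catr _ _ [:: t_ v; u_ v.+1] [:: u_ v]).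
by_relation rel_tu_pred.
Qed.

(** Folding [n+1] onto [v] and applying [a] amounts to applying [a] first, which
moves [n+1] to the first element above the new codomain, and then folding this
element onto the image of [v]. *)
Lemma fold_letter a n N v : valid a n -> v <= n -> n <= N ->
  word_eq N.+1 (fold_word n v ++ [:: a])
    (a :: fold_word (target a n) (letter_fun a v)).
Proof.
case: a => j /= an vn nN; [exact: fold_d| |exact: fold_t].
by case: n an vn nN => [|n]; [lia|exact: fold_u].
Qed.

Lemma letter_fun_le a n v : valid a n -> v <= n -> letter_fun a v <= target a n.
Proof. by case: a => j /=; split_ifs; lia. Qed.

(** * Moving the domain above the codomain *)

Lemma nseq_rcons T k (x : T) : nseq k.+1 x = nseq k x ++ [:: x].
Proof. by rewrite -addn1 nseqD. Qed.

Lemma wtarget_nseq m k j : wtarget m (nseq k (d_ j)) = m + k.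
Proof. by elim: k m => [|k IH] m /=; rewrite ?addn0 // IH addnS. Qed.

Lemma top_t k m j : j < k ->
   word_eq m (nseq k.+1 (d_ 0) ++ [:: t_ j]) (nseq k.+1 (d_ 0)).
Proof.
elim: k j m => [//|k IH] j m jk; case: j jk => [|j] jk.
  rewrite 2!nseq_rcons -!catA; apply: word_eq_catl; rewrite wtarget_nseq.
  apply: (@word_eq_trans _ _ [:: d_ 0; d_ 1]).
    by apply: word_eq_cons; by_relation rel_dt_eq.
  by apply: word_eq_sym; by_relation rel_dd_ge.
rewrite nseq_rcons -catA.
apply: (@word_eq_trans _ _ (nseq k.+1 (d_ 0) ++ [:: t_ j; d_ 0])).
  apply: word_eq_catl; rewrite wtarget_nseq; by_relation rel_dt_lt.
by rewrite (catA _ [:: t_ j] [:: d_ 0]); apply: word_eq_catr; apply: IH.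
Qed.

Lemma top_d k m j : j <= k ->
  word_eq m (nseq k (d_ 0) ++ [:: d_ j]) (nseq k.+1 (d_ 0)).
Proof.
elim: k j m => [|k IH] [|j] m jk //;
  try by rewrite -nseq_rcons; apply: word_eq_refl.
rewrite nseq_rcons -catA.
apply: (@word_eq_trans _ _ (nseq k (d_ 0) ++ [:: d_ j; d_ 0])).
  apply: word_eq_catl; rewrite wtarget_nseq; by_relation rel_dd_lt.
by rewrite (nseq_rcons k.+1) (catA _ [:: d_ j]); apply: word_eq_catr; apply: IH.
Qed.

Lemma top_z k m j : j <= k ->
  word_eq m (nseq k.+1 (d_ 0) ++ z_ j) (nseq k.+1 (d_ 0)).
Proof.
elim: j => [|j IH] jk; first by rewrite cats0; apply: word_eq_refl.
rewrite z_cons -cat1s catA.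
apply: word_eq_trans (word_eq_catr _ (top_t _ jk)) _.
by apply: IH; apply: ltnW.
Qed.

(** The image of [d_0^(n+1)] lies above [[n]], where [a] only shifts. *)
Lemma top_letter a m n : valid a n ->
  word_eq m (nseq n.+1 (d_ 0) ++ [:: a]) (nseq (target a n).+1 (d_ 0)).
Proof.
case: a => j an; [exact: (@top_d n.+1)| |exact: (@top_t n)].
case: n an => [|n] an; first by move: an => /=; lia.
apply: (@word_eq_trans _ _ (nseq n.+1 (d_ 0) ++ z_ j.-1)).
  rewrite (nseq_rcons n.+1) -catA; apply: word_eq_catl; rewrite wtarget_nseq.
  apply: word_eq_rel; first exact: rel_du_0.
    by move: an => /=; lia.
  by move: an; rewrite wvalid_z /=; lia.
by move: an; rewrite /= => an; apply: (@top_z n); lia.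
Qed.

(** * Normal forms *)

Definition fold_words n s := flatten [seq fold_word n v | v <- s].

(** The word for the function into [[n]] with the list [s] of values. *)
Definition normal_form n s := nseq n.+1 (d_ 0) ++ fold_words n s.

Lemma fold_words_letter a n m s :
  valid a n -> all (leq^~ n) s -> n + size s <= m ->
  word_eq m (fold_words n s ++ [:: a])
        (a :: fold_words (target a n) [seq letter_fun a v | v <- s]).
Proof.
move=> an; elim: s m => [|v s IH] m /=; first by move=> *; apply: word_eq_refl.
case/andP=> vn sn; case: m => [|m] nm; first lia.
rewrite /fold_words /= -/(fold_words _ _) -/(fold_words _ _) -catA.
apply: word_eq_trans (word_eq_catl (IH _ _ _)) _ => //.
  by rewrite wtarget_fold /=; lia.
rewrite -cat1s catA -cat_cons.
by apply: word_eq_catr; apply: fold_letter => //; lia.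
Qed.

(** The dimension [m] may exceed [size s - 1], which describes a function
extended by additional top elements. *)
Lemma normal_form_letter a n m s :
  valid a n -> all (leq^~ n) s -> size s <= m.+1 ->
  word_eq m (normal_form n s ++ [:: a])
    (normal_form (target a n) [seq letter_fun a v | v <- s]).
Proof.
move=> an sn sm; rewrite /normal_form -catA.
apply: word_eq_trans (word_eq_catl (fold_words_letter _ _ _)) _ => //.
  by rewrite wtarget_nseq; lia.
by rewrite -cat1s catA; apply: word_eq_catr; apply: top_letter.
Qed.

Lemma normal_form_word w n m s :
  wvalid n w -> all (leq^~ n) s -> size s <= m.+1 ->
  word_eq m (normal_form n s ++ w)
    (normal_form (wtarget n w) [seq word_fun w v | v <- s]).
Proof.
elim: w n s => [|a w IH] n s /=.
  by move=> _ _ _; rewrite cats0 map_id; apply: word_eq_refl.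
case/andP=> an wn sn sm.
apply: (@word_eq_trans _ _ ((normal_form n s ++ [:: a]) ++ w)).
  by rewrite -(catA (normal_form n s) [:: a] w); apply: word_eq_refl.
apply: word_eq_trans (word_eq_catr _ (normal_form_letter _ _ _)) _ => //.
apply: word_eq_trans (IH _ _ _ _ _) _ => //; rewrite ?size_map //.
- by rewrite all_map; apply: sub_all sn => v; apply: letter_fun_le.
- by rewrite -map_comp; apply: word_eq_refl.
Qed.

(** By [d_(v+1) t_v = d_v] the left side for [v+1] is the left side for [v]
followed by [t_v], which cancels the last letter of the right side; the
relation [d_0 u_(k+1) = z_k] starts the induction. *)
Lemma d_fold k m v : v <= k <= m ->
  word_eq m (d_ v :: fold_word k v) [seq t_ i | i <- rev (iota v (k - v))].
Proof.
elim: v => [|v IH] vm.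
  rewrite subn0; apply: word_eq_rel; first exact: rel_du_0.
    by rewrite /=; lia.
  by rewrite wvalid_z; lia.
rewrite /=.
apply: (@word_eq_trans _ _ ([:: d_ v] ++ fold_word k v ++ [:: t_ v])).
  rewrite catA; apply: (@word_eq_catr _ _ [:: d_ v.+1; t_ v] [:: d_ v]).
  by_relation rel_dt_succ.
rewrite catA; apply: word_eq_trans (word_eq_catr _ (IH _)) _; first lia.
rewrite (_ : k - v = (k - v.+1).+1) /= ?rev_cons ?map_rcons; last lia.
rewrite -cats1 -catA -[X in word_eq _ _ X]cats0; apply: word_eq_catl.
set s := [seq _ | _ <- _]; have -> : wtarget m s = m.
  by rewrite /s; elim: (rev _) => //= ? ? ->.
by apply: tt_cancel; lia.
Qed.

(** For [k > 0] the word is the normal form of the identity of [[k-1]].  Adding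
one more element to it multiplies it by [d_k], by [normal_form_letter], and
appends [fold_word k k], and [d_k] cancels this last factor. *)
Lemma normal_form_id k m : k <= m.+1 ->
  word_eq m (nseq k (d_ 0) ++ fold_words k.-1 (iota 0 k)) [::].
Proof.
elim: k => [|k IH] km; first exact: word_eq_refl.
rewrite -addn1 iotaD /fold_words map_cat flatten_cat -/(fold_words _ _).
rewrite /= cats0 !add0n addn1 /=.
have d_fold0 : word_eq m (d_ k :: fold_word k k) [::].
  by have := @d_fold k m k; rewrite subnn; apply; lia.
case: k IH km d_fold0 => [|k] IH km d_fold0; first by [].
have {IH} := IH (ltnW km); rewrite -/(normal_form k _) => IH.
rewrite -cat_cons -/(nseq k.+2 (d_ 0)) catA -/(normal_form k.+1 _).
apply: word_eq_trans d_fold0; rewrite -cat1s; apply: word_eq_catr.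
have -> : iota 0 k.+1 = [seq letter_fun (d_ k.+1) v | v <- iota 0 k.+1].
  by rewrite -[LHS]map_id; apply/eq_in_map => v; rewrite mem_iota /= => ->.
apply: word_eq_trans (word_eq_catr [:: d_ k.+1] IH).
apply/word_eq_sym/(@normal_form_letter (d_ k.+1) k m).
- exact: leqnn.
- by apply/allP => v; rewrite mem_iota.
- by rewrite size_iota ltnW.
Qed.

(** Multiply the normal form of the identity by [w]. *)
Lemma word_normal_form m w : wvalid m w ->
  word_eq m w (normal_form (wtarget m w) [seq word_fun w v | v <- iota 0 m.+1]).
Proof.
move=> mw.
apply: word_eq_trans (normal_form_word mw _ _); rewrite ?size_iota //.
  by apply/word_eq_sym/(@word_eq_catr _ w _ [::])/(@normal_form_id m.+1).
by apply/allP => v; rewrite mem_iota.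
Qed.

(** * Every function has a normal form *)

Lemma word_fun_fold n v k : v <= n ->
  word_fun (fold_word n v) k =
    if k <= n then k else if k == n.+1 then v else k.-1.
Proof.
elim: v k => [|v IH] k vn //=.
by rewrite -/(word_fun _ _) word_fun_cat IH ?(ltnW vn) //=; split_ifs; lia.
Qed.

Lemma word_fun_nseq k i : word_fun (nseq k (d_ 0)) i = i + k.
Proof.
by elim: k i => [|k IH] i /=; rewrite ?addn0 // -/(word_fun _ _) IH addnS.
Qed.

Lemma word_fun_folds_low n s k : all (leq^~ n) s -> k <= n ->
  word_fun (fold_words n s) k = k.
Proof.
elim: s => //= v s IH /andP[vn sn] kn.
rewrite /fold_words /= word_fun_cat word_fun_fold // kn.
by rewrite -/(fold_words _ _) IH.
Qed.

Lemma word_fun_normal_form n s k : all (leq^~ n) s -> k < size s ->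
  word_fun (normal_form n s) k = nth 0 s k.
Proof.
move=> sn ks; rewrite /normal_form word_fun_cat word_fun_nseq.
elim: s k sn ks => //= v s IH k /andP[vn sn] ks.
rewrite /fold_words /= word_fun_cat word_fun_fold // -/(fold_words _ _).
case: k ks => [|k] ks; first by rewrite add0n ltnn eqxx word_fun_folds_low.
by rewrite !ifF /= ?IH //; lia.
Qed.

Lemma wvalid_fold n v m : v <= n < m -> wvalid m (fold_word n v).
Proof.
elim: v => [|v IH] vn /=; first lia.
by rewrite wvalid_cat wtarget_fold IH /=; lia.
Qed.

Lemma wtarget_folds n s m : wtarget m (fold_words n s) = m - size s.
Proof.
elim: s m => [|v s IH] m; first by rewrite subn0.
rewrite /fold_words /= wtarget_cat wtarget_fold -/(fold_words _ _) IH.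
by lia.
Qed.

Lemma wvalid_folds n s m : all (leq^~ n) s -> n + size s <= m ->
  wvalid m (fold_words n s).
Proof.
elim: s m => //= v s IH m /andP[vn sn] nm.
by rewrite /fold_words /= wvalid_cat wvalid_fold ?wtarget_fold ?IH //; lia.
Qed.

Lemma wvalid_nseq m k : wvalid m (nseq k (d_ 0)).
Proof. by elim: k m => /=. Qed.

Lemma wvalid_normal_form n s m : all (leq^~ n) s -> size s <= m.+1 ->
  wvalid m (normal_form n s).
Proof.
move=> sn sm; rewrite /normal_form wvalid_cat wvalid_nseq wvalid_folds //.
by rewrite wtarget_nseq; lia.
Qed.

Lemma wtarget_normal_form n s m : size s = m.+1 ->
  wtarget m (normal_form n s) = n.
Proof.
move=> sm; rewrite /normal_form wtarget_cat wtarget_nseq wtarget_folds sm.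
by lia.
Qed.

(** * From words to paths *)

Notation path := (quiver_path generator).

Lemma word_cat n k m (q : path k m) (p : path n k) :
  word (pcat q p) = word q ++ word p.
Proof. by elim: q p => //= x y z a q IH p; rewrite IH. Qed.

Lemma word_valid n m (p : path n m) :
  wvalid m (word p) /\ wtarget m (word p) = n.
Proof.
elim: p => //= x y z [a /= aP] p [pok pt].
by move: aP; rewrite arrowE => /andP[/eqP <- ->].
Qed.

Lemma word_path m w : wvalid m w -> exists p : path (wtarget m w) m, word p = w.
Proof.
elim: w m => [|a w IH] m /=; first by exists (Defs.Nil m).
case/andP=> am /IH[p pw].
have aP : arrow a (target a m) m by rewrite arrowE eqxx.
by exists (Defs.Cons (exist _ a aP : generator _ _) p); rewrite /= pw.
Qed.

(** The intermediate objects of a path can be read off from its word and its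
second endpoint; the first endpoint has to be left free in the induction. *)
Lemma word_inj_Tagged x z (p : path x z) x' (p' : path x' z) :
  word p = word p' -> Tagged (path^~ z) p = Tagged (path^~ z) p'.
Proof.
elim: p x' p' => {x z} [x|x y z a p IH] x' p'.
  by case: x' x / p' => // x' y' x a' p'.
case: x' z / p' a => [//|x' y' z a' p'] a [aa' pp'].
have Ey : y = y'.
  move: (svalP a) (svalP a'); rewrite -aa' !arrowE.
  by move=> /andP[/eqP yE _] /andP[/eqP y'E _]; rewrite yE y'E.
case: y' / Ey a' p' aa' pp' => a' p' /val_inj <- /IH pp'.
exact: (congr1 (fun s => Tagged (path^~ z) (Defs.Cons a (tagged s))) pp').
Qed.

Lemma word_inj n m : injective (@word n m).
Proof.
move=> p q /word_inj_Tagged pq.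
exact: eq_from_Tagged pq.
Qed.

(** The equality of the targets and of validity is what makes the words in the
middle of a derivation come from paths. *)
Lemma word_eq_cong m w w' : word_eq m w w' ->
  [/\ wtarget m w = wtarget m w' , wvalid m w = wvalid m w' &
  forall n (p q : path n m), word p = w -> word q = w' -> cong relation p q].
Proof.
elim=> {m w w'}.
- move=> m l r lr ml mr; split; [exact: word_rel_target|by rewrite ml mr|].
  by move=> n p q pl qr; apply: cong_rel; rewrite /relation pl qr.
- by move=> m w; split=> // n p q <- /word_inj->; apply: cong_refl.
- by move=> m w1 w2 _ [-> -> h]; split=> // n p q pw qw; apply/cong_sym/h.
- move=> m w1 w2 w3 _ [t12 o12 h12] _ [t23 o23 h23].
  split; rewrite ?t12 ?o12 //.
  move=> n p q pw qw; have [pok pt] := word_valid p.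
  move: pok pt; rewrite pw o12 t12 => /word_path[r rw] tn.
  case: n / tn p q pw qw => p q pw qw.
  exact: cong_trans (h12 _ p r _ _) (h23 _ r q _ _).
- move=> m w1 w1' w2 w2' _ [t1 o1 h1] _ [t2 o2 h2].
  rewrite !wtarget_cat !wvalid_cat -t1 -o1 -t2 -o2; split=> // n p q pw qw.
  have [] := word_valid p; rewrite pw wvalid_cat wtarget_cat => /andP[m1 m2] tn.
  have [p1 pw1] := word_path m1; have [p2 pw2] := word_path m2.
  have [q1 qw1] : exists q1 : path (wtarget m w1) m, word q1 = w1'.
    by rewrite t1; apply: word_path; rewrite -o1.
  have [q2 qw2] : exists q2 : path (wtarget (wtarget m w1) w2) (wtarget m w1),
      word q2 = w2'.
    by rewrite t2; apply: word_path; rewrite -o2.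
  case: n / tn p q pw qw => p q pw qw.
  have -> : p = pcat p1 p2 by apply: word_inj; rewrite word_cat pw pw1 pw2.
  have -> : q = pcat q1 q2 by apply: word_inj; rewrite word_cat qw qw1 qw2.
  by apply: (@cong_comp free_gen); [apply: h1|apply: h2].
Qed.

(** * The interpretation is well defined, full and faithful *)

Lemma eval_fun n m (p : path n m) (k : 'I_m.+1) :
  eval (B := opposite Fin) (o := id) generator_fun p k = word_fun (word p) k
    :> nat.
Proof. by elim: p k => [x|x y z a p IH] k //=; rewrite IH. Qed.

Lemma interpE n m (p : path n m) (k : 'I_m.+1) :
  fhom interp p k = word_fun (word p) k :> nat.
Proof. exact: eval_fun. Qed.

Lemma interp_respects : respects relation interp.
Proof.
move=> n m p q pq; apply: funext => k; apply: val_inj; rewrite /= !interpE.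
apply: (@word_rel_fun m _ _ _ pq).
  by case: (word_valid p).
by case: (word_valid q).
Qed.

Lemma interp_faithful n m (p q : path n m) :
  fhom interp p = fhom interp q -> cong relation p q.
Proof.
move=> pq; have [pok pt] := word_valid p; have [qok qt] := word_valid q.
have pq' : word_eq m (word p) (word q).
  apply: word_eq_trans (word_normal_form pok) _; apply: word_eq_sym.
  apply: word_eq_trans (word_normal_form qok) _; rewrite pt qt.
  suff -> : [seq word_fun (word q) v | v <- iota 0 m.+1] =
            [seq word_fun (word p) v | v <- iota 0 m.+1] by apply: word_eq_refl.
  apply/eq_in_map => v; rewrite mem_iota => vm.
  by rewrite -(interpE q (Ordinal vm)) -(interpE p (Ordinal vm)) pq.
by have [_ _] := word_eq_cong pq'; apply.
Qed.

Lemma interp_full n m (f : 'I_m.+1 -> 'I_n.+1) :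
  exists p : path n m, fhom interp p = f.
Proof.
pose s := [seq f k : nat | k <- enum 'I_m.+1].
have sn : all (leq^~ n) s.
  by apply/allP => v /mapP[k _ ->]; rewrite -ltnS.
have ss : size s = m.+1 by rewrite size_map size_enum_ord.
have sok : wvalid m (normal_form n s).
  by apply: wvalid_normal_form => //; rewrite ss.
have [p pw] : exists p : path n m, word p = normal_form n s.
  by have := word_path sok; rewrite (wtarget_normal_form n ss).
exists p; apply: funext => k; apply: val_inj; rewrite /= interpE pw.
rewrite word_fun_normal_form ?ss // (nth_map ord0) ?size_enum_ord //.
by rewrite nth_ord_enum.
Qed.

Lemma functor_eq (A B : category) (o : A -> B)
    (h h' : forall x y : A, hom x y -> hom (o x) (o y)) e1 eM e1' eM' :
  (forall x y (f : hom x y), h x y f = h' x y f) ->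
  @Functor A B o h e1 eM = @Functor A B o h' e1' eM'.
Proof.
move=> hh'; have Eh : h = h'.
  by do 2![apply: functional_extensionality_dep => ?]; apply: funext => f.
case: h' / Eh e1' eM' {hh'} => e1' eM'.
by rewrite (Prop_irrelevance e1 e1') (Prop_irrelevance eM eM').
Qed.

Theorem mainTheorem1 :
  exists wd : respects relation interp,
    is_isomorphism
      (quotient_lift wd : functor presented_category (opposite Fin)).
Proof.
exists interp_respects; set L := quotient_lift _.
have Linj n m : injective (@fhom _ _ L n m).
  move=> a b; rewrite -[a]qreprK -[b]qreprK !quotient_liftE => /interp_faithful.
  by move/qclassP.
have Lsurj n m (f : @hom (opposite Fin) n m) :
    exists a : @hom presented_category n m, fhom L a = f.
  have [p <-] := interp_full f; exists (qclass relation p).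
  exact: quotient_liftE.
pose g n m (f : @hom (opposite Fin) n m) : @hom presented_category n m :=
  projT1 (cid (Lsurj n m f)).
have gK n m (f : @hom (opposite Fin) n m) : fhom L (g n m f) = f.
  exact: projT2 (cid (Lsurj n m f)).
have g1 n : g n n (idc (n : opposite Fin)) = idc (n : presented_category).
  by apply: Linj; rewrite gK fhom1.
have gM n m k (f' : @hom (opposite Fin) m k) (f : @hom (opposite Fin) n m) :
    g n k (f' \oc f) = g m k f' \oc g n m f.
  by apply: Linj; rewrite fhomM !gK.
exists (@Functor (opposite Fin) presented_category id g g1 gM).
split; apply: functor_eq => n m f /=; last exact: gK.
by apply: Linj; rewrite gK.
Qed.
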